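(* Let $n\ge2$, $0<r<n$, and $E_1>E_2>\dots>E_n>0$ (assumption A1), and assume (A2): $E_bS_{a,b}\notin\mathbb{Z}$ for all $a\in[1:r]$, $b\in[r+1:n]$. Using good triplets, define for $(a,c)\in[0:r-1]\times[r+1:n]$: $h(a,c)=\max\{b\in[r+1:n]:(a,b,c)\text{ good}\}$ (with $h(a,c)=r$ if no such $b$); for $(a,b)\in[0:r-1]\times[r+1:n]$: $e(a,b)=\min\{c\in[r+1:n]:(a,b,c)\text{ good}\}$ (with $e(a,b)=n+1$ if none); for $(b,c)\in[r+1:n]^2$: $g(b,c)=\min\{a\in[0:r-1]:(a,b,c)\text{ good}\}$ (with $g(b,c)=r$ if none). Let $\mathcal{X}_1=\{(a,c)\in[0:r-1]\times[r+1:n]: h(a,c)>r\}$, $\mathcal{X}_2=\{(a,b)\in[0:r-1]\times[r+1:n]: b<e(a,b)\le n\}$, $\mathcal{X}_3=\{(b,c)\in[r+1:n]^2: b\le c,\ 0<g(b,c)\le r-1\}$. Define: - for $(a,c)\in\mathcal{X}_1$, with $b=\min\{h(a,c),c\}$ and $\delta=r-a+b-c$: $p^{1,a,c}_k=1$ for $1\le k\le a$; $=\frac{\delta}{E_kS_{a+1,b}}$ for $a+1\le k\le b$; $=1$ for $b+1\le k\le c$; $=0$ otherwise; and $\gamma^{1,a,c}=\delta/S_{a+1,b}$; - for $(a,b)\in\mathcal{X}_2$, with $c=e(a,b)$: $p^{2,a,b}_k=1$ for $1\le k\le a$; $=E_b/E_k$ for $a+1\le k\le b$; $=1$ for $b+1\le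 k\le c-1$; $=r-a+b-c-E_bS_{a+1,b-1}$ for $k=c$; $=0$ otherwise; and $\gamma^{2,a,b}=E_b$; - for $(b,c)\in\mathcal{X}_3$, with $a=g(b,c)$: $p^{3,b,c}_k=1$ for $1\le k\le a-1$; $=r-a+b-c-E_bS_{a+1,b-1}$ for $k=a$; $=E_b/E_k$ for $a+1\le k\le b$; $=1$ for $b+1\le k\le c$; $=0$ otherwise; and $\gamma^{3,b,c}=E_b$; - $p^0_k=1$ for $k\le r$, $p^0_k=0$ otherwise, and $\gamma^0=E_{r+1}$. Then: (1) all vectors $\mathbf{p}^{1,a,c}$ ($(a,c)\in\mathcal{X}_1$), $\mathbf{p}^{2,a,b}$ ($(a,b)\in\mathcal{X}_2$), $\mathbf{p}^{3,b,c}$ ($(b,c)\in\mathcal{X}_3$) belong to $\mathcal{I}$; (2) each of these vectors together with its $\gamma$, as well as $(\mathbf{p}^0,\gamma^0)$, is feasible for (P-$\{1,\dots,r\}$); (3) an element of $\mathcal{A}=\{\mathbf{p}^0\}\cup\{\mathbf{p}^{1,a,c}\}_{\mathcal{X}_1}\cup\{\mathbf{p}^{2,a,b}\}_{\mathcal{X}_2}\cup\{\mathbf{p}^{3,b,c}\}_{\mathcal{X}_3}$ maximizing the objective $\sum_{j=1}^np_jE_j-\frac12\sum_{j=1}^rp_jE_j$, together with its associated $\gamma$, is an optimal solution of (P-$\{1,\dots,r\}$).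
   Context: $\mathcal{I}=\{\mathbf{p}\in[0,1]^n:\sum_kp_k=r\}$. For $1\le a,b\le n$, $S_{a,b}=\sum_{i=a}^b\frac1{E_i}$ if $b\ge a$ and $0$ otherwise. A triplet $(a,b,c)\in[0:r-1]\times[r+1:n]\times[r+1:n]$ is good if $r-a+b-c<E_bS_{a+1,b}$. (P-$\{1,\dots,r\}$) is the linear program $\max_{\mathbf{p}\in\mathcal{I},\gamma\in\mathbb{R}}\sum_{j=1}^np_jE_j-\frac12\sum_{j=1}^rp_jE_j$ subject to $p_jE_j\ge\gamma$ for $1\le j\le r$ and $\gamma\ge p_tE_t$ for $r<t\le n$. $[x:y]$ denotes the integers from $x$ to $y$ inclusive. *)

(* Defs.v *)
(* Indices are natural numbers 1..n; vectors are functions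
   nat -> R of which only the coordinates 1..n matter. *)
From mathcomp Require Import all_boot all_order all_algebra.
Set Implicit Arguments. Unset Strict Implicit. Unset Printing Implicit Defensive.
Import Order.TTheory GRing.Theory Num.Theory.
Local Open Scope ring_scope.

Section Defs.
Variable R : realFieldType.
Variables (n r : nat) (E : nat -> R).

Definition S (a b : nat) : R :=
  if (a <= b)%N then \sum_(a <= i < b.+1) (E i)^-1 else 0.

Definition dlt (a b c : nat) : R := (r%:Z - a%:Z + b%:Z - c%:Z)%:~R.

Definition good (a b c : nat) : bool :=
  [&& (a < r)%N, (r < b <= n)%N, (r < c <= n)%N & dlt a b c < E b * S a.+1 b].

Definition h (a c : nat) : nat := last r [seq b <- iota r.+1 (n - r) | good a b c].
Definition e (a b : nat) : nat := head n.+1 [seq c <- iota r.+1 (n - r) | good a b c].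
Definition g (b c : nat) : nat := head r [seq a <- iota 0 r | good a b c].

Definition X1 (a c : nat) : Prop := [/\ (a < r)%N, (r < c <= n)%N & (r < h a c)%N].
Definition X2 (a b : nat) : Prop :=
  [/\ (a < r)%N, (r < b <= n)%N & (b < e a b <= n)%N].
Definition X3 (b c : nat) : Prop :=
  [/\ (r < b <= n)%N, (r < c <= n)%N, (b <= c)%N & (0 < g b c <= r.-1)%N].

Definition p1 (a c : nat) : nat -> R := fun k =>
  let b := minn (h a c) c in
  if (1 <= k <= a)%N then 1
  else if (a.+1 <= k <= b)%N then dlt a b c / (E k * S a.+1 b)
  else if (b.+1 <= k <= c)%N then 1
  else 0.
Definition gamma1 (a c : nat) : R :=
  let b := minn (h a c) c in dlt a b c / S a.+1 b.

Definition p2 (a b : nat) : nat -> R := fun k =>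
  let c := e a b in
  if (1 <= k <= a)%N then 1
  else if (a.+1 <= k <= b)%N then E b / E k
  else if (b.+1 <= k <= c.-1)%N then 1
  else if k == c then dlt a b c - E b * S a.+1 b.-1
  else 0.
Definition gamma2 (a b : nat) : R := E b.

Definition p3 (b c : nat) : nat -> R := fun k =>
  let a := g b c in
  if (1 <= k <= a.-1)%N then 1
  else if k == a then dlt a b c - E b * S a.+1 b.-1
  else if (a.+1 <= k <= b)%N then E b / E k
  else if (b.+1 <= k <= c)%N then 1
  else 0.
Definition gamma3 (b c : nat) : R := E b.

Definition p0 : nat -> R := fun k => if (1 <= k <= r)%N then 1 else 0.
Definition gamma0 : R := E r.+1.

Definition inI (p : nat -> R) : Prop :=
  (forall k, (1 <= k <= n)%N -> 0 <= p k <= 1) /\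
  \sum_(1 <= k < n.+1) p k = r%:R.

Definition objective (p : nat -> R) : R :=
  \sum_(1 <= j < n.+1) p j * E j - 2^-1 * \sum_(1 <= j < r.+1) p j * E j.

Definition feasible (p : nat -> R) (gam : R) : Prop :=
  [/\ inI p,
      (forall j, (1 <= j <= r)%N -> gam <= p j * E j) &
      (forall t, (r < t <= n)%N -> p t * E t <= gam)].

Definition optimal (p : nat -> R) (gam : R) : Prop :=
  feasible p gam /\
  forall q del, feasible q del -> objective q <= objective p.

Definition candidate (p : nat -> R) (gam : R) : Prop :=
  [\/ p = p0 /\ gam = gamma0,
      exists a c, [/\ X1 a c, p = p1 a c & gam = gamma1 a c],
      exists a b, [/\ X2 a b, p = p2 a b & gam = gamma2 a b]
    | exists b c, [/\ X3 b c, p = p3 b c & gam = gamma3 b c]].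

End Defs.

(* Main.v *)
(* Feasibility is a direct computation.  For optimality, every feasible point is
   dominated by a candidate.  Lowering gamma to at most E_{r+1} only relaxes the
   constraints.  For fixed gamma, a greedy exchange inside [1, r] and inside
   [r+1, n] leaves at most one free coordinate in each block, and moving mass
   between these two puts one of them at a bound.  Then gamma itself moves along
   a segment on which the objective is affine, and the endpoints of the segment
   are candidates: the free coordinate reaches a bound (p1), or gamma reaches
   some E_b (p2 and p3).  Assumption A2 makes the inequalities found there
   strict, as goodness requires.  The only segment with another kind of endpoint
   is the one whose free coordinate is r+1: it is extended to gamma = 2 E_{r+1},
   where the objective is below that of p0. *)
Require Import Defs.
From mathcomp Require Import all_boot all_order all_algebra.
From mathcomp Require Import zify ring lra.
Import Order.TTheory GRing.Theory Num.Theory.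
Local Open Scope ring_scope.

(** * Last and first elements of a filtered integer interval *)

Lemma last_filter_iota (P : pred nat) (x0 m N : nat) :
  let l := last x0 [seq i <- iota m N | P i] in
  (l = x0 /\ forall i, (m <= i < m + N)%N -> ~~ P i) \/
  [/\ P l, (m <= l < m + N)%N & forall i, (m <= i < m + N)%N -> P i -> (i <= l)%N].
Proof.
elim: N => [|N IH]; first by left; split=> // i; lia.
rewrite -{1 2 3}[N.+1]addn1 iotaD filter_cat last_cat /=.
case: ifP => [Pm|/negbT Pm] /=; first by right; split=> // [|i]; lia.
case: IH => [[-> H]|[H1 H2 H3]]; [left|right]; split => //.
- move=> i Hi; case: (eqVneq i (m + N)%N) => [->//|?]; apply: H; lia.
- lia.
- move=> i Hi Pi; case: (eqVneq i (m + N)%N) => [e|?]; last by apply: H3 => //; lia.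
  by rewrite -e Pi in Pm.
Qed.

Lemma head_filter_iota (P : pred nat) (x0 m N : nat) :
  let l := head x0 [seq i <- iota m N | P i] in
  (l = x0 /\ forall i, (m <= i < m + N)%N -> ~~ P i) \/
  [/\ P l, (m <= l < m + N)%N & forall i, (m <= i < m + N)%N -> P i -> (l <= i)%N].
Proof.
elim: N m => [|N IH] m /=; first by left; split=> // i; lia.
case: ifP => [Pm|/negbT Pm] /=; first by right; split=> // [|i]; lia.
case: (IH m.+1) => [[-> H]|[H1 H2 H3]]; [left|right]; split => //.
- move=> i Hi; case: (eqVneq i m) => [->//|?]; apply: H; lia.
- lia.
- move=> i Hi Pi; case: (eqVneq i m) => [e|?]; last by apply: H3 => //; lia.
  by rewrite -e Pi in Pm.
Qed.

(** * Greedy exchange inside one block of coordinates *)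

Section Greedy.
Variables (R : realFieldType) (m M : nat) (l u w q : nat -> R).
Hypothesis mM : (m < M)%N.
Hypothesis lqu : forall i, (m <= i < M)%N -> l i <= q i <= u i.
Hypothesis w_dec : forall i j, (m <= i)%N -> (i <= j)%N -> (j < M)%N -> w j <= w i.

(** The weights do not increase along the block, so moving mass to smaller indices within the bounds
    cannot lower the weighted sum. What results is at its upper bounds before some [c] and at its
    lower bounds after it; [x] takes the rest of the total. *)
Lemma greedy_exchange :
  exists c x, [/\ (m <= c < M)%N, l c <= x <= u c,
    \sum_(m <= i < M) (if (i < c)%N then u i else if i == c then x else l i) =
      \sum_(m <= i < M) q i &
    \sum_(m <= i < M) w i * q i <=
      \sum_(m <= i < M) w i * (if (i < c)%N then u i else if i == c then x else l i)].
Proof.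
pose T j := \sum_(m <= i < M) (if (i < j)%N then u i else l i).
pose s := \sum_(m <= i < M) q i.
have sT : s <= T M.
  apply: ler_sum_nat => i /andP[mi iM]; rewrite iM.
  by have /andP[] : l i <= q i <= u i by apply: lqu; rewrite mi.
have Ts : T m <= s.
  apply: ler_sum_nat => i /andP[mi iM]; rewrite ltnNge mi /=.
  by have /andP[] : l i <= q i <= u i by apply: lqu; rewrite mi.
(* The switch index [c] will be the predecessor of the first [j > m] with [s <= T j]. *)
have exj : exists j, (m < j)%N && (s <= T j) by exists M; rewrite mM.
have [j /andP[mj sTj] jmin] := ex_minnP exj.
have jM : (j <= M)%N by apply: jmin; rewrite mM.
have Tj1 : T j.-1 <= s.
  case: (eqVneq j m.+1) => [->//|jm]; rewrite leNgt; apply/negP => /ltW H.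
  by have := jmin j.-1; rewrite H andbT => /(_ ltac:(lia)); lia.
pose c := j.-1; have cM : (m <= c < M)%N by rewrite /c; lia.
have jE : j = c.+1 by rewrite /c; lia.
pose P x i := if (i < c)%N then u i else if i == c then x else l i.
have sumP x : \sum_(m <= i < M) P x i = T c + (x - l c).
  rewrite /T (big_cat_nat (n:=c)) ?(big_cat_nat (n:=c) (m:=m) (p:=M)) //=; try lia.
  rewrite (big_ltn (m:=c)) ?(big_ltn (m:=c) (n:=M)) //; try lia.
  rewrite /P !ltnn eqxx.
  have e1 : \sum_(m <= i < c) (if (i < c)%N then u i else if i == c then x else l i)
     = \sum_(m <= i < c) (if (i < c)%N then u i else l i).
    by apply: eq_big_nat => i Hi; case: ltngtP => //; lia.
  have e2 : \sum_(c.+1 <= i < M) (if (i < c)%N then u i else if i == c then x else l i)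
     = \sum_(c.+1 <= i < M) (if (i < c)%N then u i else l i).
    by apply: eq_big_nat => i Hi; case: ltngtP => //; lia.
  rewrite e1 e2; ring.
have Tc : T j = T c + (u c - l c).
  rewrite -(sumP (u c)); apply: eq_big_nat => i Hi; rewrite /P jE ltnS leq_eqVlt.
  by case: ltngtP => // ->.
pose x := s - T c + l c.
exists c, x; split => //.
- by rewrite /x; move: Tj1 sTj; rewrite -/c Tc => *; apply/andP; split; lra.
- by rewrite -/(P x) sumP /x -/s; ring.
rewrite -subr_ge0 -sumrB.
(* Both vectors have the same total, so [w c] can be subtracted from every weight. In each term
   [(w i - w c) * (P x i - q i)] the two factors then never have opposite signs. *)
have w0 : 0 = w c * (\sum_(m <= i < M) P x i - \sum_(m <= i < M) q i).
  by rewrite sumP /x -/s; ring.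
rewrite [leLHS]w0 -sumrB mulr_sumr; apply: ler_sum_nat => i Hi.
rewrite -/(P x i) -mulrBr -subr_ge0 -mulrBl.
have := lqu i Hi; rewrite /P; case: ltngtP => ic /andP[lq qu].
- by apply: mulr_ge0; rewrite subr_ge0 //; apply: w_dec; lia.
- by rewrite -mulrNN; apply: mulr_ge0; rewrite oppr_ge0 subr_le0 //; apply: w_dec; lia.
- by rewrite ic subrr mul0r.
Qed.

End Greedy.

Ltac natlia :=
  repeat match goal with
  | H : is_true (Order.le _ _) |- _ => clear H
  | H : is_true (Order.lt _ _) |- _ => clear H
  | H : _ -> is_true (Order.le _ _) |- _ => clear H
  | H : _ -> is_true (Order.lt _ _) |- _ => clear H
  | H : @eq (Num.RealField.sort _) _ _ |- _ => clear H
  | H : forall _, _ |- _ => clear H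
  end; lia.

Ltac rlra := repeat match goal with H : @eq nat _ _ |- _ => clear H end; lra.

Lemma sum_ones (R : realFieldType) (F : nat -> R) (m N : nat) :
  (m <= N)%N -> (forall k, (m <= k < N)%N -> F k = 1) ->
  \sum_(m <= k < N) F k = N%:R - m%:R.
Proof.
move=> mN F1; rewrite (eq_big_nat _ _ F1) sumr_const_nat.
by rewrite -natrB.
Qed.

(** * Order of the [E i], recurrences for [S] and [dlt] *)

Section Program.
Variables (R : realFieldType) (n r : nat) (E : nat -> R).
Hypothesis r_gt0 : (0 < r)%N.
Hypothesis r_lt_n : (r < n)%N.
Hypothesis E_dec : forall i, (1 <= i)%N -> (i < n)%N -> E i.+1 < E i.
Hypothesis En_gt0 : 0 < E n.
Hypothesis E_nonint : forall a b, (1 <= a <= r)%N -> (r < b <= n)%N ->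
  forall z : int, E b * S E a b != z%:~R.

Local Notation S := (S E).
Local Notation dlt := (dlt R r).
Local Notation good := (good n r E).
Local Notation objective := (objective n r E).

Lemma E_lt i j : (1 <= i)%N -> (i < j)%N -> (j <= n)%N -> E j < E i.
Proof.
move=> i1; elim: j => // j IH; rewrite ltnS leq_eqVlt => /orP[/eqP <- jn|ij jn].
  exact: E_dec.
by apply: lt_trans (IH ij (ltnW jn)); apply: E_dec => //; natlia.
Qed.

Lemma E_le i j : (1 <= i)%N -> (i <= j)%N -> (j <= n)%N -> E j <= E i.
Proof.
move=> i1; rewrite leq_eqVlt => /orP[/eqP -> //|ij jn]; exact/ltW/E_lt.
Qed.

Lemma E_gt0 i : (1 <= i)%N -> (i <= n)%N -> 0 < E i.
Proof. by move=> i1 iN; apply: lt_le_trans En_gt0 (E_le _ _ i1 iN (leqnn n)). Qed.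

Lemma S_sum a b : S a b = \sum_(a <= i < b.+1) (E i)^-1.
Proof. by rewrite /Defs.S; case: leqP => // ba; rewrite big_geq. Qed.

Lemma S_recr a b : (a <= b.+1)%N -> S a b.+1 = S a b + (E b.+1)^-1.
Proof. by move=> ab; rewrite !S_sum big_nat_recr. Qed.

Lemma S_recl a b : (a <= b)%N -> S a b = (E a)^-1 + S a.+1 b.
Proof. by move=> ab; rewrite !S_sum big_ltn. Qed.

Lemma S_ge0 a b : (1 <= a)%N -> (b <= n)%N -> 0 <= S a b.
Proof.
move=> a1 bn; rewrite S_sum big_nat; apply: sumr_ge0 => i Hi.
by rewrite invr_ge0; apply/ltW/E_gt0; natlia.
Qed.

Lemma S_gt0 a b : (1 <= a)%N -> (a <= b)%N -> (b <= n)%N -> 0 < S a b.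
Proof.
move=> a1 ab bn; rewrite S_recl //; apply: ltr_wpDr; first by apply: S_ge0; natlia.
by rewrite invr_gt0; apply: E_gt0; natlia.
Qed.

Lemma E_S_recr a b : (a <= b.+1)%N -> (b < n)%N ->
  E b.+1 * S a b.+1 = E b.+1 * S a b + 1.
Proof.
by move=> ab bn; rewrite S_recr // mulrDr divff //; apply/lt0r_neq0/E_gt0.
Qed.

Lemma dltE a b c : dlt a b c = r%:R - a%:R + b%:R - c%:R :> R.
Proof. by rewrite /Defs.dlt !(rmorphB, rmorphD). Qed.

Lemma dlt_recb a b c : dlt a b.+1 c = dlt a b c + 1.
Proof. by rewrite !dltE -natr1; ring. Qed.

Lemma dlt_recc a b c : dlt a b c.+1 = dlt a b c - 1.
Proof. by rewrite !dltE -natr1; ring. Qed.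

Lemma dlt_reca a b c : dlt a.+1 b c = dlt a b c - 1.
Proof. by rewrite !dltE -natr1; ring. Qed.

Lemma goodE a b c : (a < r)%N -> (r < b <= n)%N -> (r < c <= n)%N ->
  good a b c = (dlt a b c < E b * S a.+1 b).
Proof. by move=> Ha Hb Hc; rewrite /Defs.good Ha Hb Hc. Qed.

Lemma good_range a b c : good a b c ->
  [/\ (a < r)%N, (r < b <= n)%N, (r < c <= n)%N & dlt a b c < E b * S a.+1 b].
Proof. by case/and4P. Qed.

(** [dlt a b c] is an integer and, by (A2), [E b * S a.+1 b] is not, so equality is excluded. *)
Lemma good_le a b c : (a < r)%N -> (r < b <= n)%N -> (r < c <= n)%N ->
  dlt a b c <= E b * S a.+1 b -> good a b c.
Proof.
move=> Ha Hb Hc; rewrite goodE // lt_neqAle => -> ; rewrite andbT eq_sym.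
by apply: E_nonint; natlia.
Qed.

(** Both [dlt a b.+1 c] and [E b.+1 * S a.+1 b.+1] contain an extra 1 that cancels; what remains is
    weakened by [E b.+1 <= E b]. *)
Lemma good_predb a b c : (r < b)%N -> good a b.+1 c -> good a b c.
Proof.
move=> rb /good_range[Ha Hb Hc]; rewrite E_S_recr ?dlt_recb; try natlia.
rewrite goodE; try natlia; rewrite ltrD2r => /lt_le_trans; apply.
by apply: ler_wpM2r; [apply: S_ge0 | apply: E_le]; natlia.
Qed.

Lemma good_downb a b b' c : (r < b)%N -> (b <= b')%N -> good a b' c -> good a b c.
Proof.
move=> rb; elim: b' => [|b' IH]; first by natlia.
rewrite leq_eqVlt => /orP[/eqP -> //|]; rewrite ltnS => bb' G.
by apply: IH => //; apply: good_predb G; natlia.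
Qed.

Lemma good_upc a b c c' : (c <= c')%N -> (c' <= n)%N -> good a b c -> good a b c'.
Proof.
move=> cc' c'n /good_range[Ha Hb Hc]; rewrite goodE; try natlia.
apply: le_lt_trans; rewrite !dltE lerD2l lerN2 ler_nat; natlia.
Qed.

(** The left side drops by 1, the right side only by [E b / E a.+1 < 1]. *)
Lemma good_succa a b c : (a.+1 < r)%N -> good a b c -> good a.+1 b c.
Proof.
move=> Ha1 /good_range[Ha Hb Hc]; rewrite goodE; try natlia.
rewrite dlt_reca (S_recl a.+1 b); last natlia.
have : E b / E a.+1 < 1 by rewrite ltr_pdivrMr ?mul1r; [apply: E_lt | apply: E_gt0]; natlia.
lra.
Qed.

Lemma good_upa a a' b c : (a <= a')%N -> (a' < r)%N -> good a b c -> good a' b c.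
Proof.
move=> aa' a'r G; elim: a' aa' a'r => [|a' IH]; first by case: a G.
rewrite leq_eqVlt => /orP[/eqP <- //|]; rewrite ltnS => aa' a'r.
by apply: good_succa => //; apply: IH => //; natlia.
Qed.

(** [good] contains the ranges of its indices, so the extremum over the searched interval is one
    over all naturals. *)
Lemma hP a c : (h n r E a c = r /\ forall b, ~~ good a b c) \/
  (good a (h n r E a c) c /\ forall b, good a b c -> (b <= h n r E a c)%N).
Proof.
have := last_filter_iota (fun b => good a b c) r r.+1 (n - r).
rewrite -/(h n r E a c) /= => -[[-> H]|[H1 H2 H3]]; [left|right]; split=> // b.
  apply/negP => G; have [_ Hb _ _] := good_range _ _ _ G.
  by move/negP: (H b ltac:(natlia)); apply.
by move=> G; have [_ Hb _ _] := good_range _ _ _ G; apply: H3 => //; natlia.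
Qed.

Lemma eP a b : (e n r E a b = n.+1 /\ forall c, ~~ good a b c) \/
  (good a b (e n r E a b) /\ forall c, good a b c -> (e n r E a b <= c)%N).
Proof.
have := head_filter_iota (fun c => good a b c) n.+1 r.+1 (n - r).
rewrite -/(e n r E a b) /= => -[[-> H]|[H1 H2 H3]]; [left|right]; split=> // c.
  apply/negP => G; have [_ _ Hc _] := good_range _ _ _ G.
  by move/negP: (H c ltac:(natlia)); apply.
by move=> G; have [_ _ Hc _] := good_range _ _ _ G; apply: H3 => //; natlia.
Qed.

Lemma gP b c : (g n r E b c = r /\ forall a, ~~ good a b c) \/
  (good (g n r E b c) b c /\ forall a, good a b c -> (g n r E b c <= a)%N).
Proof.
have := head_filter_iota (fun a => good a b c) r 0 r.
rewrite -/(g n r E b c) /= => -[[-> H]|[H1 H2 H3]]; [left|right]; split=> // a.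
  apply/negP => G; have [Ha _ _ _] := good_range _ _ _ G.
  by move/negP: (H a ltac:(natlia)); apply.
by move=> G; have [Ha _ _ _] := good_range _ _ _ G; apply: H3 => //; natlia.
Qed.

(** Goodness is downward closed in [b], so one failure at [b.+1] certifies the maximum. For [e] and
    [g] it is upward closed in [c] and in [a]. *)
Lemma h_eq a b c : good a b c -> ((b < n)%N -> ~~ good a b.+1 c) -> h n r E a c = b.
Proof.
move=> G N; case: (hP a c) => [[_ /(_ b)]|[Gh M]]; first by rewrite G.
have := M b G; have [_ Hb _ _] := good_range _ _ _ G.
have [_ Hh _ _] := good_range _ _ _ Gh.
rewrite leq_eqVlt => /orP[/eqP //|bh].
have /negP[] : ~~ good a b.+1 c by apply: N; natlia.
by apply: good_downb Gh => //; natlia.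
Qed.

Lemma e_eq a b c : good a b c -> ((r.+1 < c)%N -> ~~ good a b c.-1) -> e n r E a b = c.
Proof.
move=> G N; case: (eP a b) => [[_ /(_ c)]|[Ge M]]; first by rewrite G.
have := M c G; have [_ _ Hc _] := good_range _ _ _ G.
have [_ _ He _] := good_range _ _ _ Ge.
rewrite leq_eqVlt => /orP[/eqP //|ec].
have /negP[] : ~~ good a b c.-1 by apply: N; natlia.
by apply: good_upc Ge; natlia.
Qed.

Lemma g_eq a b c : good a b c -> ((0 < a)%N -> ~~ good a.-1 b c) -> g n r E b c = a.
Proof.
move=> G N; case: (gP b c) => [[_ /(_ a)]|[Gg M]]; first by rewrite G.
have := M a G; have [Ha _ _ _] := good_range _ _ _ G.
rewrite leq_eqVlt => /orP[/eqP //|ga].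
have /negP[] : ~~ good a.-1 b c by apply: N; natlia.
by apply: good_upa Gg; natlia.
Qed.

(** * Profiles, their mass and the objective *)

(* The common shape of p1, p2, p3 and of all intermediate points.  On the
   coordinates 1..n, the value [x] does not occur when [a = 0], nor [y] when
   [c = n.+1]. *)
Definition profile (a b c : nat) (gam x y : R) : nat -> R := fun k =>
  if (k < a)%N then 1 else if k == a then x
  else if (k <= b)%N then gam / E k
  else if (k < c)%N then 1 else if k == c then y else 0.

(** The mass consists of [a - 1] ones, [x], the middle block, [c - 1 - b] ones and [y]. When
    [a = 0], taking [x = 1] cancels the spurious -1; when [c = n.+1], taking [y = 0] removes the
    absent coordinate. One formula thus covers all cases. *)
Lemma sum_profile a b c gam x y : ((0 < a)%N \/ x = 1) -> ((c <= n)%N \/ y = 0) ->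
  (a <= b < c)%N -> (c <= n.+1)%N ->
  \sum_(1 <= k < n.+1) profile a b c gam x y k =
    gam * S a.+1 b + x + y - 1 + a%:R + c%:R - 1 - b%:R.
Proof.
move=> Hx Hy Hb Hc.
have sum_mid : \sum_(a.+1 <= k < n.+1) profile a b c gam x y k =
    gam * S a.+1 b + y + c%:R - 1 - b%:R.
  rewrite (big_cat_nat (n:=b.+1)) //=; try natlia.
  rewrite (big_cat_nat (n:=c) (m:=b.+1)) //=; try natlia.
  have -> : \sum_(a.+1 <= k < b.+1) profile a b c gam x y k = gam * S a.+1 b.
    rewrite S_sum mulr_sumr; apply: eq_big_nat => k Hk; rewrite /profile.
    by do ?[case: ifP; try natlia].
  have -> : \sum_(b.+1 <= k < c) profile a b c gam x y k = c%:R - 1 - b%:R.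
    rewrite sum_ones -?natr1; [by ring | natlia |] => k Hk.
    by rewrite /profile; do ?[case: ifP; try natlia].
  have -> : \sum_(c <= k < n.+1) profile a b c gam x y k = y; last by ring.
  have rest : \sum_(c.+1 <= k < n.+1) profile a b c gam x y k = 0.
    rewrite big_nat; apply: big1 => k Hk; rewrite /profile.
    by do ?[case: ifP; try natlia].
  case: (ltnP c n.+1) => cn; last by rewrite big_geq //; case: Hy => //; natlia.
  rewrite big_ltn // rest addr0 /profile ltnn eqxx.
  by do ?[case: ifP; try natlia].
case: a Hx Hb sum_mid => [|a] Hx Hb sum_mid.
  by rewrite sum_mid; case: Hx => // ->; ring.
rewrite (big_cat_nat (n:=a.+1)) //=; try natlia.
rewrite (big_ltn (m:=a.+1)); last natlia.
rewrite sum_mid.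
have -> : \sum_(1 <= k < a.+1) profile a.+1 b c gam x y k = a%:R.
  rewrite sum_ones -?natr1; [by ring | natlia |] => k Hk.
  by rewrite /profile; do ?[case: ifP; try natlia].
rewrite {1}/profile ltnn eqxx -[a.+1%:R]natr1; ring.
Qed.

(** Decreasing on [1, r] and on [r+1, n], but possibly jumping up from r to r+1; hence one exchange
    per block. *)
Definition weight (k : nat) : R := (if (k <= r)%N then 2^-1 else 1) * E k.

Lemma objective_weight p : objective p = \sum_(1 <= k < n.+1) weight k * p k.
Proof.
rewrite /Defs.objective (big_cat_nat (n:=r.+1)) //=; try natlia.
rewrite [RHS](big_cat_nat (n:=r.+1)) //=; try natlia.
have -> : \sum_(r.+1 <= k < n.+1) weight k * p k = \sum_(r.+1 <= k < n.+1) p k * E k.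
  apply: eq_big_nat => k Hk; rewrite /weight leqNgt.
  by case: ltnP; [rewrite mul1r mulrC | natlia].
have -> : \sum_(1 <= k < r.+1) weight k * p k = 2^-1 * \sum_(1 <= k < r.+1) p k * E k.
  rewrite mulr_sumr; apply: eq_big_nat => k Hk; rewrite /weight; case: leqP; last natlia.
  by move=> _; ring.
lra.
Qed.

Lemma eq_objective p q : (forall k, (1 <= k <= n)%N -> p k = q k) ->
  objective p = objective q.
Proof.
by move=> pq; rewrite !objective_weight; apply: eq_big_nat => k Hk; rewrite pq //; natlia.
Qed.

(** * Feasibility of profiles and of the candidates *)

Lemma eq_feasible p q gam : (forall k, (1 <= k <= n)%N -> p k = q k) ->
  feasible n r E q gam -> feasible n r E p gam.
Proof.
move=> pq [[q01 sq] q1 q2]; split; last 2 first.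
- by move=> j Hj; rewrite pq ?q1 //; natlia.
- by move=> j Hj; rewrite pq ?q2 //; natlia.
split; first by move=> k Hk; rewrite pq ?q01.
by rewrite -sq; apply: eq_big_nat => k Hk; rewrite pq //; natlia.
Qed.

(** In the middle block [p k * E k = gam], which is tight on either side of [r]; the ones beyond [b]
    are allowed because [E b.+1 <= gam]. The last hypothesis is the mass constraint solved for
    [x + y]. *)
Lemma feasible_profile a b c gam x y : (a <= r)%N -> (r < b < c)%N -> (c <= n.+1)%N ->
  0 <= gam <= E b -> ((b.+1 < c)%N -> E b.+1 <= gam) ->
  ((0 < a)%N -> gam <= x * E a) -> x <= 1 -> ((0 < a)%N \/ x = 1) ->
  0 <= y <= 1 -> ((c <= n)%N -> y * E c <= gam) -> ((c <= n)%N \/ y = 0) ->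
  x + y = dlt a b c + 2 - gam * S a.+1 b ->
  feasible n r E (profile a b c gam x y) gam.
Proof.
move=> Ha Hb Hc /andP[g0 gEb] gEb1 gx x1 Hx /andP[y0 y1] yg Hy sum.
have level k : (1 <= k <= b)%N -> 0 <= gam / E k <= 1.
  move=> Hk; have Ek : 0 < E k by apply: E_gt0; natlia.
  apply/andP; split; first by apply: divr_ge0 => //; exact: ltW.
  rewrite ler_pdivrMr // mul1r; apply: le_trans gEb _.
  by apply: E_le; natlia.
have x0 : (0 < a)%N -> 0 <= x.
  move=> a0; have Ek : 0 < E a by apply: E_gt0; natlia.
  by rewrite -(pmulr_lge0 _ Ek); apply: le_trans g0 (gx a0).
split; first split.
- move=> k Hk; rewrite /profile; case: ifP => _; first by rewrite ler01 lexx.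
  case: ifP => [/eqP ka|_]; first by rewrite x1 x0 //; natlia.
  case: ifP => [kb|_]; first by apply: level; natlia.
  case: ifP => _; first by rewrite ler01 lexx.
  by case: ifP => _; [rewrite y0 y1 | rewrite lexx ler01].
- by rewrite sum_profile //; [move: sum; rewrite dltE; lra | natlia].
- move=> j Hj; have Ej : 0 < E j by apply: E_gt0; natlia.
  rewrite /profile; case: ifP => ja.
    by rewrite mul1r; apply: le_trans gEb _; apply: E_le; natlia.
  case: ifP => [/eqP ja'|_]; first by rewrite ja'; apply: gx; natlia.
  case: ifP => jb; last by natlia.
  by rewrite divfK // lt0r_neq0.
- move=> t Ht; have Et : 0 < E t by apply: E_gt0; natlia.
  rewrite /profile; case: ifP => ta; first natlia.
  case: ifP => ta'; first natlia.
  case: ifP => tb; first by rewrite divfK // lt0r_neq0.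
  case: ifP => tc.
    by rewrite mul1r; apply: le_trans (gEb1 _); [apply: E_le | ]; natlia.
  case: ifP => [/eqP tc'|_]; last by rewrite mul0r.
  by rewrite tc'; apply: yg; natlia.
Qed.

(** No coordinate is free here: [x = 1] continues the first ones, and [y = 0] at [c.+1] lets the
    last ones reach [c]. *)
Lemma p1_profile a c k : X1 n r E a c -> (1 <= k)%N ->
  p1 n r E a c k = profile a (minn (h n r E a c) c) c.+1 (gamma1 n r E a c) 1 0 k.
Proof.
move=> [Ha Hc Hh] k1; rewrite /p1 /profile /gamma1.
set b := minn _ _; have Hb : (r < b <= c)%N by rewrite /b; natlia.
by do ?[case: ifP; try natlia] => // *; rewrite invfM mulrA mulrAC.
Qed.

Lemma p2_profile a b k : X2 n r E a b -> (1 <= k)%N ->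
  p2 n r E a b k = profile a b (e n r E a b) (gamma2 E a b) 1
    (dlt a b (e n r E a b) + 1 - E b * S a.+1 b) k.
Proof.
move=> [Ha Hb He] k1; rewrite /p2 /profile /gamma2.
set c := e _ _ _ _ _ in He *.
have -> : dlt a b c - E b * S a.+1 b.-1 = dlt a b c + 1 - E b * S a.+1 b.
  have := E_S_recr a.+1 b.-1; rewrite prednK; last natlia.
  by move=> ->; [ring|natlia..].
by do ?[case: ifP; try natlia].
Qed.

Lemma p3_profile b c k : X3 n r E b c -> (1 <= k)%N ->
  p3 n r E b c k = profile (g n r E b c) b c.+1 (gamma3 E b c)
    (dlt (g n r E b c) b c + 1 - E b * S (g n r E b c).+1 b) 0 k.
Proof.
move=> [Hb Hc bc Hg] k1; rewrite /p3 /profile /gamma3.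
set a := g _ _ _ _ _ in Hg *.
have -> : dlt a b c - E b * S a.+1 b.-1 = dlt a b c + 1 - E b * S a.+1 b.
  have := E_S_recr a.+1 b.-1; rewrite prednK; last natlia.
  by move=> ->; [ring|natlia..].
by do ?[case: ifP; try natlia].
Qed.

Lemma feasible_p0 : feasible n r E (p0 R r) (gamma0 r E).
Proof.
split; first split.
- by move=> k Hk; rewrite /p0; case: ifP => _; rewrite lexx ler01.
- rewrite (big_cat_nat (n:=r.+1)) //=; try natlia.
  rewrite sum_ones; last 2 first.
  + by natlia.
  + by move=> k Hk; rewrite /p0; case: ifP => //; natlia.
  rewrite big_nat big1 => [|k Hk]; first by rewrite -natr1; ring.
  by rewrite /p0; case: ifP => //; natlia.
- move=> j Hj; rewrite /p0 Hj mul1r; apply: E_le; natlia.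
- move=> t Ht; rewrite /p0; case: ifP => [|_]; first by natlia.
  by rewrite mul0r /gamma0; apply/ltW/E_gt0; natlia.
Qed.

Lemma feasible_p1 a c : X1 n r E a c ->
  feasible n r E (p1 n r E a c) (gamma1 n r E a c).
Proof.
move=> X; apply: eq_feasible => [k /andP[k1 _]|]; first exact: p1_profile.
have [Ha Hc Hh] := X; case: (hP a c) => [[]|[Gh hmax]]; first by natlia.
set b := minn _ _; have Hb : (r < b <= c)%N by rewrite /b; natlia.
have [_ Hhn _ _] := good_range _ _ _ Gh.
have /good_range[_ _ _ dE] : good a b c by apply: good_downb Gh; rewrite /b; natlia.
have S0 : 0 < S a.+1 b by apply: S_gt0; natlia.
have gE : gamma1 n r E a c = dlt a b c / S a.+1 b by [].
have gS : gamma1 n r E a c * S a.+1 b = dlt a b c by rewrite gE divfK // lt0r_neq0.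
have gEb : gamma1 n r E a c <= E b by rewrite gE ler_pdivrMr // ltW.
(* Here [b < c] forces [b = h a c], and a smaller gamma would make [(a, b.+1, c)] good. *)
have bnext : (b < c)%N -> E b.+1 <= gamma1 n r E a c.
  move=> bc; rewrite gE ler_pdivlMr //; rewrite leNgt; apply/negP => lt.
  have : good a b.+1 c.
    rewrite goodE; try natlia; rewrite E_S_recr; try natlia.
    by rewrite dlt_recb ltrD2r.
  by move/hmax; rewrite /b in bc *; natlia.
(* For [b < c] use the bound just proved; for [b = c], [dlt a b c] is [r - a]. *)
have g0 : 0 <= gamma1 n r E a c.
  case: (ltnP b c) => bc.
    by apply: le_trans (bnext bc); apply/ltW/E_gt0; natlia.
  have cb : c%:R = b%:R :> R by congr _%:R; natlia.
  rewrite gE; apply: divr_ge0; last exact: ltW.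
  rewrite dltE cb; have : a%:R <= r%:R :> R by rewrite ler_nat; natlia.
  by lra.
apply: feasible_profile => //; try natlia.
- by rewrite g0 gEb.
- move=> a0; rewrite mul1r; apply: le_trans gEb _; apply: E_le; natlia.
- by right.
- by rewrite lexx ler01.
- by rewrite mul0r.
- by right.
- by rewrite gS dlt_recc; ring.
Qed.

(** Goodness of [(a, b, c)] bounds the free value [y] by 1; failure at [c.-1], from the minimality
    of [e], gives [0 <= y]. *)
Lemma feasible_p2 a b : X2 n r E a b ->
  feasible n r E (p2 n r E a b) (gamma2 E a b).
Proof.
move=> X; apply: eq_feasible => [k /andP[k1 _]|]; first exact: p2_profile.
have [Ha Hb He] := X; case: (eP a b) => [[]|[Ge emin]]; first by natlia.
set c := e _ _ _ _ _ in He Ge emin *.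
have [_ _ _ dE] := good_range _ _ _ Ge.
have Eb : 0 < E b by apply: E_gt0; natlia.
have y0 : 0 <= dlt a b c + 1 - E b * S a.+1 b.
  rewrite subr_ge0 leNgt; apply/negP => lt.
  have : good a b c.-1.
    rewrite goodE; try natlia.
    by move: lt; rewrite -{1}(prednK (n:=c)) ?dlt_recc ?subrK //; natlia.
  by move/emin; natlia.
have y1 : dlt a b c + 1 - E b * S a.+1 b <= 1 by lra.
rewrite /gamma2; apply: feasible_profile => //; try natlia.
- by rewrite lexx ltW.
- by move=> _; apply: E_le; natlia.
- by move=> a0; rewrite mul1r; apply: E_le; natlia.
- by right.
- by rewrite y0 y1.
- move=> cn; have Ec : 0 < E c by apply: E_gt0; natlia.
  apply: (@le_trans _ _ (E c)); first by rewrite ger_pMl.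
  by apply: E_le; natlia.
- by ring.
Qed.

(** Goodness of [(a, b, c)] bounds the free value [x] by 1; failure at [a.-1], from the minimality
    of [g], gives [E b <= x * E a]. *)
Lemma feasible_p3 b c : X3 n r E b c ->
  feasible n r E (p3 n r E b c) (gamma3 E b c).
Proof.
move=> X; apply: eq_feasible => [k /andP[k1 _]|]; first exact: p3_profile.
have [Hb Hc bc Hg] := X; case: (gP b c) => [[]|[Gg gmin]]; first by natlia.
set a := g _ _ _ _ _ in Hg Gg gmin *.
have [_ _ _ dE] := good_range _ _ _ Gg.
have Eb : 0 < E b by apply: E_gt0; natlia.
have Ea : 0 < E a by apply: E_gt0; natlia.
have x0 : E b <= (dlt a b c + 1 - E b * S a.+1 b) * E a.
  rewrite -ler_pdivrMr // leNgt; apply/negP => lt.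
  have : good a.-1 b c.
    rewrite goodE; try natlia.
    rewrite (prednK (n:=a)); last natlia.
    have := dlt_reca a.-1 b c; rewrite prednK; last natlia.
    by rewrite S_recl ?mulrDr; [lra | natlia].
  by move/gmin; natlia.
rewrite /gamma3; apply: feasible_profile => //; try natlia.
- by rewrite lexx ltW.
- by move=> bc1; apply: E_le; natlia.
- by lra.
- by rewrite lexx ler01.
- by rewrite mul0r ltW.
- by right.
- by rewrite dlt_recc; ring.
Qed.

(** * Several descriptions of one vector *)

(** When a free coordinate or [gam] reaches a bound, some coordinate can be counted in a
    neighbouring block. This and the next three identities turn the end of a segment into a profile
    with shifted indices. *)
Lemma profile_absorb_x a b c gam y k : (0 < a <= b)%N ->
  profile a b c gam (gam / E a) y k = profile a.-1 b c gam 1 y k.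
Proof.
move=> Hab; rewrite /profile; case: (eqVneq k a) => [->|ka]; by do ?[case: ifP; try natlia].
Qed.

Lemma profile_absorb_y a b c gam x k : (a <= b < c)%N ->
  profile a b c gam x 1 k = profile a b c.+1 gam x 0 k.
Proof. by move=> Hab; rewrite /profile; do ?[case: ifP; try natlia]. Qed.

Lemma profile_absorb_b a b c x y k : (a <= b)%N -> (b.+1 < c)%N -> (b < n)%N ->
  profile a b c (E b.+1) x y k = profile a b.+1 c (E b.+1) x y k.
Proof.
move=> ab bc bn; rewrite /profile; case: (eqVneq k b.+1) => [->|kb].
  rewrite divff; last by apply/lt0r_neq0/E_gt0.
  by do ?[case: ifP; try natlia].
by do ?[case: ifP; try natlia].
Qed.

Lemma profile_absorb_yb a b gam x k : (a <= b)%N ->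
  profile a b b.+1 gam x (gam / E b.+1) k = profile a b.+1 b.+2 gam x 0 k.
Proof.
move=> ab; rewrite /profile; case: (eqVneq k b.+1) => [->|kb];
  by do ?[case: ifP; try natlia].
Qed.

(** * Domination by a candidate, and its propagation along segments *)

Definition dominated (p : nat -> R) : Prop :=
  exists q del, candidate n r E q del /\ objective p <= objective q.

Lemma dominated_le p q : objective p <= objective q -> dominated q -> dominated p.
Proof. by move=> pq [q' [del [C qq']]]; exists q', del; split=> //; apply: le_trans qq'. Qed.

Lemma dominated_eq p q : (forall k, (1 <= k <= n)%N -> p k = q k) ->
  dominated q -> dominated p.
Proof. by move=> /eq_objective pq; apply: dominated_le; rewrite pq. Qed.

Lemma weight_gt0 k : (1 <= k <= n)%N -> 0 < weight k.
Proof.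
move=> Hk; apply: mulr_gt0; last by apply: E_gt0; natlia.
by case: ifP => _; rewrite ?invr_gt0 ?ltr01 ?ltr0n.
Qed.

Lemma dominated_p0 p : objective p <= objective (p0 R r) -> dominated p.
Proof. by exists (p0 R r), (gamma0 r E); split=> //; constructor 1. Qed.

Lemma dominated_le_p0 p : (forall k, (1 <= k <= n)%N -> p k <= p0 R r k) -> dominated p.
Proof.
move=> pp0; apply: dominated_p0; rewrite !objective_weight; apply: ler_sum_nat => k Hk.
by rewrite ler_pM2l; [apply: pp0 | apply: weight_gt0]; natlia.
Qed.

(** The objective is affine along [F], so the endpoint chosen by the sign of the slope [B] is at
    least as good. Domination does not include feasibility, so a segment may leave the feasible
    set. *)
Lemma dominated_line (F : R -> nat -> R) L U t :
  (forall s k, F s k = F 0 k + s * (F 1 k - F 0 k)) ->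
  L <= t <= U -> dominated (F L) -> dominated (F U) -> dominated (F t).
Proof.
move=> aff /andP[Lt tU] DL DU.
pose B := \sum_(1 <= k < n.+1) weight k * (F 1 k - F 0 k).
have obj s : objective (F s) = objective (F 0) + s * B.
  rewrite !objective_weight /B mulr_sumr -big_split /=.
  by apply: eq_bigr => k _; rewrite aff; ring.
case: (leP 0 B) => B0.
  by apply: dominated_le DU; rewrite (obj t) (obj U) lerD2l; apply: ler_wpM2r.
by apply: dominated_le DL; rewrite (obj t) (obj L) lerD2l ler_wnM2r // ltW.
Qed.

(** With [s = S a.+1 b], the free coordinate compensates the change of mass in the middle block. *)
Lemma dominated_line_x a b c x0 s g L U : L <= g <= U ->
  dominated (profile a b c L (x0 - L * s) 0) ->
  dominated (profile a b c U (x0 - U * s) 0) ->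
  dominated (profile a b c g (x0 - g * s) 0).
Proof.
apply: (dominated_line (fun g => profile a b c g (x0 - g * s) 0)) => {}g k.
by rewrite /profile; do ?case: ifP => _; ring.
Qed.

Lemma dominated_line_y a b c y0 s g L U : L <= g <= U ->
  dominated (profile a b c L 1 (y0 - L * s)) ->
  dominated (profile a b c U 1 (y0 - U * s)) ->
  dominated (profile a b c g 1 (y0 - g * s)).
Proof.
apply: (dominated_line (fun g => profile a b c g 1 (y0 - g * s))) => {}g k.
by rewrite /profile; do ?case: ifP => _; ring.
Qed.

Lemma dominated_line_xy a b c g x y L U : L <= 0 <= U ->
  dominated (profile a b c g (x + L) (y - L)) ->
  dominated (profile a b c g (x + U) (y - U)) ->
  dominated (profile a b c g x y).
Proof.
move=> LU DL DU; rewrite -[x]addr0 -[y]subr0.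
apply: (dominated_line (fun t => profile a b c g (x + t) (y - t)) L U) => // t k.
by rewrite /profile; do ?case: ifP => _; ring.
Qed.

(** * Profiles that are candidates *)

(** [gam <= E b] is goodness of [(a, b, c)], strict by (A2), and [E b.+1 <= gam] is its failure at
    [b.+1]; together they identify [b] as the minimum of [h a c] and [c]. *)
Lemma dominated_vertex1 a b c gam : (a < r)%N -> (r < b <= c)%N -> (c <= n)%N ->
  gam * S a.+1 b = dlt a b c -> gam <= E b -> ((b < c)%N -> E b.+1 <= gam) ->
  dominated (profile a b c.+1 gam 1 0).
Proof.
move=> Ha Hb Hc gS gE gE1.
have S0 : 0 < S a.+1 b by apply: S_gt0; natlia.
have G : good a b c.
  by apply: good_le; try natlia; rewrite -gS ler_wpM2r // ltW.
have hb : minn (h n r E a c) c = b.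
  case: (ltnP b c) => bc.
    rewrite (h_eq a b c) //; first by natlia.
    move=> bn; rewrite goodE; try natlia.
    rewrite E_S_recr; try natlia.
    rewrite dlt_recb ltrD2r -gS -leNgt ler_pM2r //; exact: gE1.
  case: (hP a c) => [[_ /(_ b)]|[_ /(_ b G)]]; last natlia.
  by rewrite G.
have X : X1 n r E a c by split; natlia.
exists (p1 n r E a c), (gamma1 n r E a c); split; first by constructor 2; exists a, c.
rewrite le_eqVlt; apply/orP; left; apply/eqP; apply: eq_objective => k /andP[k1 _].
rewrite p1_profile // /gamma1 hb -gS mulfK //; exact: lt0r_neq0.
Qed.

(** [y <= 1] amounts to goodness of [(a, b, c)] and [0 <= y] to failure at [c.-1], so
    [c = e a b]. *)
Lemma dominated_vertex2 a b c y : (a < r)%N -> (r < b < c)%N -> (c <= n)%N ->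
  y = dlt a b c + 1 - E b * S a.+1 b -> 0 <= y <= 1 ->
  dominated (profile a b c (E b) 1 y).
Proof.
move=> Ha Hb Hc yE /andP[y0 y1].
have G : good a b c by apply: good_le; try natlia; lra.
have ec : e n r E a b = c.
  apply: e_eq => // rc; rewrite goodE; try natlia.
  have := dlt_recc a b c.-1; rewrite prednK; last natlia.
  by rewrite -leNgt; lra.
have X : X2 n r E a b by split; natlia.
exists (p2 n r E a b), (gamma2 E a b); split; first by constructor 3; exists a, b.
rewrite le_eqVlt; apply/orP; left; apply/eqP; apply: eq_objective => k /andP[k1 _].
by rewrite p2_profile // ec -yE.
Qed.

(** [x <= 1] amounts to goodness of [(a, b, c)] and [E b <= x * E a] to failure at [a.-1], so
    [a = g b c]. *)
Lemma dominated_vertex3 a b c x : (0 < a < r)%N -> (r < b <= c)%N -> (c <= n)%N ->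
  x = dlt a b c + 1 - E b * S a.+1 b -> E b <= x * E a -> x <= 1 ->
  dominated (profile a b c.+1 (E b) x 0).
Proof.
move=> Ha Hb Hc xE x0 x1.
have G : good a b c by apply: good_le; try natlia; lra.
have Ea : 0 < E a by apply: E_gt0; natlia.
have ga : g n r E b c = a.
  apply: g_eq => // a0; rewrite goodE; try natlia.
  have := dlt_reca a.-1 b c; rewrite prednK // => d.
  rewrite -ler_pdivrMr // in x0.
  rewrite S_recl ?mulrDr; last natlia.
  by rewrite -leNgt; lra.
have X : X3 n r E b c by split; natlia.
exists (p3 n r E b c), (gamma3 E b c); split; first by constructor 4; exists b, c.
rewrite le_eqVlt; apply/orP; left; apply/eqP; apply: eq_objective => k /andP[k1 _].
by rewrite p3_profile // ga -xE.
Qed.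

(** * Profiles with one free coordinate *)

(** Slide [gam]. Downwards, either [x] reaches 1 ([p1], or [p0] if [a = r]) or [gam] reaches
    [E b.+1] ([p3] at [b.+1]). Upwards, either [gam] reaches [E b] ([p3]) or [x] reaches [gam / E a]
    ([p1] at [a.-1]). *)
Lemma dominated_low a b c gam x : (0 < a <= r)%N -> (r < b <= c)%N -> (c <= n)%N ->
  0 <= gam <= E b -> ((b < c)%N -> E b.+1 <= gam) -> gam <= x * E a -> x <= 1 ->
  x = dlt a b c + 1 - gam * S a.+1 b -> dominated (profile a b c.+1 gam x 0).
Proof.
move=> Ha Hb Hc /andP[g0 gE] gE1 gx x1 xE.
have Ea : 0 < E a by apply: E_gt0; natlia.
have S1 : 0 < S a.+1 b by apply: S_gt0; natlia.
have S0E : S a b = (E a)^-1 + S a.+1 b by apply: S_recl; natlia.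
have S0 : 0 < S a b by apply: S_gt0; natlia.
have gd : dlt a b c <= gam * S a.+1 b by rlra.
have gd1 : gam * S a b <= dlt a b c + 1.
  by rewrite S0E mulrDr; move: gx; rewrite -ler_pdivrMr //; rlra.
have bcR : b%:R <= c%:R :> R by rewrite ler_nat; natlia.
have bc1R : (b < c)%N -> b%:R + 1 <= c%:R :> R by move=> ?; rewrite natr1 ler_nat.
(* If [a = r] and [b < c], then [gam * S a b <= b - c + 1 <= 0], although [gam] is positive. *)
have low_bc : a = r -> b = c.
  move=> ar; case: (ltnP b c) => [bc|]; last by natlia.
  exfalso; have : 0 < gam * S a b.
    apply: mulr_gt0 => //; apply: lt_le_trans (gE1 bc); apply: E_gt0; natlia.
  by have := bc1R bc; move: gd1; rewrite dltE ar; rlra.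
rewrite {1}xE.
have [L [Lg DL]] : exists L, L <= gam /\
    dominated (profile a b c.+1 L (dlt a b c + 1 - L * S a.+1 b) 0).
  have vertex L : L * S a.+1 b = dlt a b c -> L <= gam ->
      ((b < c)%N -> E b.+1 <= L) ->
      dominated (profile a b c.+1 L (dlt a b c + 1 - L * S a.+1 b) 0).
    move=> LS Lg LE; rewrite LS addrAC subrr add0r.
    case: (ltnP a r) => ar.
      by apply: dominated_vertex1 => //; apply: le_trans gE.
    have {ar} ar : a = r by natlia.
    have cb := low_bc ar.
    have L0 : L = 0.
      have : L * S a.+1 b = 0 by rewrite LS dltE ar cb; ring.
      by move/eqP; rewrite mulf_eq0 (gt_eqF S1) orbF => /eqP.
    apply: dominated_le_p0 => k Hk; rewrite L0 /profile /p0 mul0r.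
    by do ?[case: ifP; try natlia]; rewrite ?ler01.
  have LS : dlt a b c / S a.+1 b * S a.+1 b = dlt a b c by rewrite divfK // lt0r_neq0.
  have Lg : dlt a b c / S a.+1 b <= gam by rewrite ler_pdivrMr.
  case: (ltnP b c) => bc; last first.
    by exists (dlt a b c / S a.+1 b); split=> //; apply: vertex => //; natlia.
  case: (leP (dlt a b c) (E b.+1 * S a.+1 b)) => dE; last first.
    exists (dlt a b c / S a.+1 b); split=> //; apply: vertex => // _.
    by rewrite ler_pdivlMr // ltW.
  have ES : E b.+1 * S a b <= dlt a b c + 1.
    by apply: le_trans gd1; rewrite ler_pM2r //; apply: gE1.
  exists (E b.+1); split; first exact: gE1.
  apply: dominated_eq => [k _|]; first by apply: profile_absorb_b; natlia.
  have aner : a <> r by move/low_bc; natlia.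
  apply: dominated_vertex3; try natlia.
  - by rewrite E_S_recr ?dlt_recb; [ring | natlia..].
  - by rewrite -ler_pdivrMr //; move: ES; rewrite S0E mulrDr; rlra.
  - by rlra.
have [U [gU DU]] : exists U, gam <= U /\
    dominated (profile a b c.+1 U (dlt a b c + 1 - U * S a.+1 b) 0).
  case: (leP (E b * S a b) (dlt a b c + 1)) => dE.
    exists (E b); split=> //; case: (ltnP a r) => ar; last first.
      (* For [a = r] this case is void: [E b * S r b] exceeds 1, since its last term is 1, while
         [dlt + 1] is at most 1. *)
      have {ar} ar : a = r by natlia.
      have : 0 < E b * S a b.-1.
        by apply: mulr_gt0; [apply: E_gt0 | apply: S_gt0]; natlia.
      have := E_S_recr a b.-1; rewrite prednK; last natlia.
      move=> H; rewrite H in dE; try natlia.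
      by move: dE; rewrite dltE ar; rlra.
    apply: dominated_vertex3 => //; try natlia; last first.
      have : gam * S a.+1 b <= E b * S a.+1 b by rewrite ler_pM2r.
      by rlra.
    by rewrite -ler_pdivrMr //; move: dE; rewrite S0E mulrDr; rlra.
  (* The value of [gam] at which [x = gam / E a]. *)
  pose U := (dlt a b c + 1) / S a b.
  have US : U * S a b = dlt a b c + 1 by rewrite divfK // lt0r_neq0.
  exists U; have gU : gam <= U by rewrite ler_pdivlMr.
  split=> //.
  have -> : dlt a b c + 1 - U * S a.+1 b = U / E a.
    by rewrite -US S0E mulrDr; ring.
  apply: dominated_eq => [k _|]; first by apply: profile_absorb_x; natlia.
  apply: dominated_vertex1; try natlia.
  - rewrite prednK; last natlia.
    by have := dlt_reca a.-1 b c; rewrite prednK; [rlra | natlia].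
  - by rewrite ler_pdivrMr // ltW.
  - by move=> bc; apply: le_trans gU; apply: gE1.
by apply: dominated_line_x DL DU; rewrite Lg.
Qed.

(** Slide [gam]. Upwards, either [gam] reaches [E b] ([p2]) or [y] reaches 0 ([p1] at [c.-1]).
    Downwards, either [y] reaches 1 ([p1]), or [gam] reaches [E b.+1] with [b.+1 < c] ([p2] at
    [b.+1]), or [c = b.+1] and [y] reaches [gam / E c] ([p1] at [b.+1]). *)
Lemma dominated_high a b c gam y : (a < r)%N -> (r < b < c)%N -> (c <= n)%N ->
  0 <= gam <= E b -> ((b.+1 < c)%N -> E b.+1 <= gam) ->
  0 <= y <= 1 -> y * E c <= gam ->
  y = dlt a b c + 1 - gam * S a.+1 b -> dominated (profile a b c gam 1 y).
Proof.
move=> Ha Hb Hc /andP[g0 gE] gE1 /andP[y0 y1] yg yE.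
have S1 : 0 < S a.+1 b by apply: S_gt0; natlia.
have Ec : 0 < E c by apply: E_gt0; natlia.
have dg : dlt a b c <= gam * S a.+1 b by rlra.
have gd : gam * S a.+1 b <= dlt a b c + 1 by rlra.
rewrite yE.
have [U [gU DU]] : exists U, gam <= U /\
    dominated (profile a b c U 1 (dlt a b c + 1 - U * S a.+1 b)).
  case: (leP (E b * S a.+1 b) (dlt a b c + 1)) => dE.
    exists (E b); split=> //; apply: dominated_vertex2 => //.
    have : gam * S a.+1 b <= E b * S a.+1 b by rewrite ler_pM2r.
    by move=> ?; apply/andP; split; rlra.
  pose U := (dlt a b c + 1) / S a.+1 b.
  have US : U * S a.+1 b = dlt a b c + 1 by rewrite divfK // lt0r_neq0.
  exists U; have gU : gam <= U by rewrite ler_pdivlMr.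
  split=> //; rewrite US subrr.
  have dc := dlt_recc a b c.-1; rewrite prednK in dc; last natlia.
  have <- : c.-1.+1 = c by natlia.
  apply: dominated_vertex1; try natlia.
  - by rlra.
  - by rewrite ler_pdivrMr // ltW.
  - by move=> bc; apply: le_trans gU; apply: gE1; natlia.
have [L [Lg DL]] : exists L, L <= gam /\
    dominated (profile a b c L 1 (dlt a b c + 1 - L * S a.+1 b)).
  pose L := dlt a b c / S a.+1 b.
  have LS : L * S a.+1 b = dlt a b c by rewrite divfK // lt0r_neq0.
  have Lg : L <= gam by rewrite ler_pdivrMr.
  have vertex : E b.+1 <= L ->
      dominated (profile a b c L 1 (dlt a b c + 1 - L * S a.+1 b)).
    move=> EL; rewrite LS addrAC subrr add0r.
    apply: dominated_eq => [k _|]; first by apply: profile_absorb_y; natlia.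
    apply: dominated_vertex1 => //; try natlia.
    exact: le_trans gE.
  case: (ltnP b.+1 c) => bc.
    case: (leP (E b.+1) L) => EL; first by exists L; split=> //; apply: vertex.
    have ELS : dlt a b c < E b.+1 * S a.+1 b by rewrite -LS ltr_pM2r.
    exists (E b.+1); split; first exact: gE1.
    have EgS : E b.+1 * S a.+1 b <= gam * S a.+1 b by rewrite ler_pM2r //; apply: gE1.
    apply: dominated_eq => [k _|]; first by apply: profile_absorb_b; natlia.
    apply: dominated_vertex2; try natlia.
    - by rewrite E_S_recr ?dlt_recb; [ring | natlia..].
    - by apply/andP; split; rlra.
  have cb : c = b.+1 by natlia.
  rewrite cb in Hc Ec yg dg gd yE L LS Lg vertex *.
  have S2E := S_recr a.+1 b ltac:(natlia).
  have S2 : 0 < S a.+1 b.+1 by apply: S_gt0; natlia.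
  (* The value of [gam] at which [y = gam / E b.+1]. *)
  pose K := (dlt a b b.+1 + 1) / S a.+1 b.+1.
  have KS : K * S a.+1 b.+1 = dlt a b b.+1 + 1 by rewrite divfK // lt0r_neq0.
  have KS' : K * S a.+1 b + K / E b.+1 = dlt a b b.+1 + 1 by rewrite -KS S2E mulrDr.
  case: (leP K (E b.+1)) => KE.
    exists K; split.
      rewrite ler_pdivrMr // S2E mulrDr.
      by rewrite -ler_pdivlMr // in yg; rlra.
    have -> : dlt a b b.+1 + 1 - K * S a.+1 b = K / E b.+1 by rlra.
    apply: dominated_eq => [k _|]; first by apply: profile_absorb_yb; natlia.
    apply: dominated_vertex1 => //; try natlia.
    by rewrite KS dlt_recb.
  (* At [K] the value of [y] exceeds 1, so going down [y] meets 1 first, at some [L >= K]. *)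
  exists L; split=> //; apply: vertex.
  have K1 : 1 < K / E b.+1 by rewrite ltr_pdivlMr // mul1r.
  have KL : K <= L by rewrite -(ler_pM2r S1) LS; rlra.
  exact: le_trans (ltW KE) KL.
by apply: dominated_line_y DL DU; rewrite Lg.
Qed.

(* With e = E_{r+1}, the difference is the sum over a < k <= r of
   (E_k - 2 e)^2 / (2 E_k); the vector need not be feasible. *)
Lemma objective_profile_first_le_p0 a : (a < r)%N ->
  objective (profile a r r.+1 (2 * E r.+1) 1
    (r%:R - a%:R - 2 * E r.+1 * S a.+1 r)) <= objective (p0 R r).
Proof.
move=> Ha; set y := r%:R - _ - _; set P := profile _ _ _ _ _ _.
rewrite -subr_ge0 !objective_weight -sumrB.
rewrite (big_cat_nat (n:=a.+1)) //=; try natlia.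
rewrite (big_cat_nat (n:=r.+1) (m:=a.+1)) //=; try natlia.
rewrite (big_ltn (m:=r.+1)); last natlia.
have -> : \sum_(1 <= k < a.+1) (weight k * p0 R r k - weight k * P k) = 0.
  rewrite big_nat; apply: big1 => k Hk; rewrite /P /p0 /profile.
  by do ?[case: ifP; try natlia]; rewrite subrr.
have -> : \sum_(r.+2 <= k < n.+1) (weight k * p0 R r k - weight k * P k) = 0.
  rewrite big_nat; apply: big1 => k Hk; rewrite /P /p0 /profile.
  by do ?[case: ifP; try natlia]; rewrite subrr.
have -> : weight r.+1 * p0 R r r.+1 - weight r.+1 * P r.+1 = - (E r.+1 * y).
  rewrite /weight /P /p0 /profile ltnn andbF eqxx.
  by do ?[case: ifP; try natlia] => *; ring.
have yE : y = \sum_(a.+1 <= k < r.+1) (1 - 2 * E r.+1 / E k).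
  rewrite sumrB sum_ones //; last by natlia.
  by rewrite -mulr_sumr -S_sum -!natr1 /y; ring.
rewrite add0r addr0 yE mulr_sumr -sumrB big_nat; apply: sumr_ge0 => k Hk.
have Ek : 0 < E k by apply: E_gt0; natlia.
have -> : weight k * p0 R r k - weight k * P k - E r.+1 * (1 - 2 * E r.+1 / E k) =
    (E k - 2 * E r.+1) ^+ 2 / (2 * E k).
  rewrite /weight /P /p0 /profile; do ?[case: ifP; try natlia] => *.
  by field; rewrite lt0r_neq0.
by apply: divr_ge0; [apply: sqr_ge0 | apply: mulr_ge0; rewrite ?ler0n // ltW].
Qed.

(** At the lower end [y = gam / E r.+1]: coordinate r+1 joins the middle block, which gives [p1]
    with [b = c = r.+1]. The upper end is the comparison with [p0] just proved. *)
Lemma dominated_first a gam y : (a < r)%N -> gam <= E r.+1 -> y * E r.+1 <= gam ->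
  y = r%:R - a%:R - gam * S a.+1 r -> dominated (profile a r r.+1 gam 1 y).
Proof.
move=> Ha gE yg yE; have Er : 0 < E r.+1 by apply: E_gt0; natlia.
have S2 : 0 < S a.+1 r.+1 by apply: S_gt0; natlia.
have S2E : S a.+1 r.+1 = S a.+1 r + (E r.+1)^-1 by apply: S_recr; natlia.
pose L := (r%:R - a%:R) / S a.+1 r.+1.
have LS : L * S a.+1 r.+1 = r%:R - a%:R by rewrite divfK // lt0r_neq0.
have Lg : L <= gam.
  rewrite ler_pdivrMr // S2E mulrDr.
  by rewrite -ler_pdivlMr // in yg; rlra.
rewrite yE; apply: (dominated_line_y _ _ _ _ _ _ L (2 * E r.+1)).
- by rewrite Lg; rlra.
- have -> : r%:R - a%:R - L * S a.+1 r = L / E r.+1.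
    by rewrite -LS S2E mulrDr; ring.
  apply: dominated_eq => [k _|]; first by apply: profile_absorb_yb; natlia.
  apply: dominated_vertex1; try natlia.
  + by rewrite LS dltE; ring.
  + exact: le_trans gE.
- by apply: dominated_p0; apply: objective_profile_first_le_p0.
Qed.

Lemma dominated_x1 a b c gam y : (a <= r)%N -> (r <= b < c)%N -> (c <= n)%N ->
  0 <= gam <= E r.+1 -> ((r < b)%N -> gam <= E b) -> ((r.+1 < c)%N -> (r < b)%N) ->
  ((b.+1 < c)%N -> E b.+1 <= gam) -> 0 <= y <= 1 -> y * E c <= gam ->
  y = dlt a b c + 1 - gam * S a.+1 b -> dominated (profile a b c gam 1 y).
Proof.
move=> Ha Hb Hc /andP[g0 gEr] gE rb gE1 y01 yg yE.
case: (ltnP a r) => ar.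
  case: (ltnP r b) => rb'.
    by apply: dominated_high => //; [natlia | rewrite g0 gE].
  have br : b = r by natlia.
  have cr : c = r.+1 by case: (ltnP r.+1 c) => [/rb|]; natlia.
  rewrite br cr in yg yE *; apply: dominated_first => //.
  by rewrite yE dltE -natr1; ring.
have {ar} ar : a = r by natlia.
have bcR : b%:R + 1 <= c%:R :> R by rewrite natr1 ler_nat; natlia.
have gS : 0 <= gam * S a.+1 b by apply: mulr_ge0 => //; apply: S_ge0; natlia.
have /andP[y0 _] := y01.
(* When [a = r] and [x = 1], the ones on [1, r] already carry the whole mass, so nothing is left
   beyond [r]. *)
have [yz gSz cz] : [/\ y = 0, gam * S a.+1 b = 0 & c%:R = b.+1%:R :> R].
  by move: yE; rewrite dltE ar -[b.+1%:R]natr1 -ar => yE; split; rlra.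
have {}cz : c = b.+1 by apply/eqP; rewrite -(eqr_nat R) cz.
apply: dominated_le_p0 => k Hk; rewrite /p0 /profile yz.
do ?[case: ifP; try natlia] => //; rewrite ?ler01 // => *.
have : 0 < S a.+1 b by apply: S_gt0; natlia.
move/eqP: gSz; rewrite mulf_eq0 => /orP[/eqP ->|/eqP ->]; rewrite ?ltxx ?mul0r //.
Qed.

(** * Profiles with two free coordinates *)

(** Mass moves between [x] and [y] at fixed [gam]. Towards [x] it stops at [x = 1] or [y = 0],
    towards [y] at [x = gam / E a] or at the cap of [y]; each stop leaves at most one free
    coordinate. *)
Lemma dominated_profile a b c gam x y :
  (0 < a <= r)%N -> (r <= b < c)%N -> (c <= n)%N ->
  0 <= gam <= E r.+1 -> ((r < b)%N -> gam <= E b) -> ((r.+1 < c)%N -> (r < b)%N) ->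
  ((b.+1 < c)%N -> E b.+1 <= gam) ->
  gam / E a <= x <= 1 -> 0 <= y <= Num.min 1 (gam / E c) ->
  x + y = dlt a b c + 2 - gam * S a.+1 b ->
  dominated (profile a b c gam x y).
Proof.
move=> Ha Hb Hc /andP[g0 gEr] gE rb gE1 /andP[gx x1] /andP[y0 yu] xy.
have Ea : 0 < E a by apply: E_gt0; natlia.
have Ec : 0 < E c by apply: E_gt0; natlia.
have [y1 yg] : y <= 1 /\ y <= gam / E c by move: yu; rewrite le_min => /andP.
have [U [U0 DU]] : exists U, 0 <= U /\ dominated (profile a b c gam (x + U) (y - U)).
  case: (leP (1 - x) y) => xy1.
    exists (1 - x); split; first by rlra.
    rewrite (_ : x + (1 - x) = 1); last by ring.
    apply: dominated_x1 => //; try natlia.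
    - by rewrite g0.
    - by apply/andP; split; rlra.
    - by rewrite -ler_pdivlMr //; rlra.
    - by rlra.
  exists y; split => //; rewrite subrr.
  case: (ltnP r.+1 c) => rc.
    have dc := dlt_recc a b c.-1; rewrite prednK in dc; last natlia.
    have cE : c = c.-1.+1 by natlia.
    have rb' := rb rc; rewrite cE; apply: dominated_low; try natlia.
    - by rewrite g0; apply: gE.
    - by move=> bc; apply: gE1; natlia.
    - by rewrite -ler_pdivrMr //; rlra.
    - by rlra.
    - by rlra.
  have cr : c = r.+1 by natlia.
  have br : b = r by natlia.
  apply: dominated_le_p0 => k Hk; rewrite /p0 /profile cr br.
  (* With [c = r.+1] and [y = 0] the vector vanishes beyond [r], hence lies below [p0]. *)
  do ?[case: ifP; try natlia] => //; rewrite ?ler01 // => *; first by rlra.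
  have Ek : 0 < E k by apply: E_gt0; natlia.
  by rewrite ler_pdivrMr // mul1r; apply: le_trans gEr _; apply: E_le; natlia.
have [T [T0 DT]] : exists T, 0 <= T /\ dominated (profile a b c gam (x - T) (y + T)).
  case: (leP (x - gam / E a) (Num.min 1 (gam / E c) - y)) => xy1.
    exists (x - gam / E a); split; first by rlra.
    rewrite opprB addrC subrK.
    have [yT1 yTg] : y + (x - gam / E a) <= 1 /\ y + (x - gam / E a) <= gam / E c.
      by apply/andP; rewrite -le_min; rlra.
    apply: dominated_eq => [k _|]; first by apply: profile_absorb_x; natlia.
    have da := dlt_reca a.-1 b c; rewrite prednK in da; last natlia.
    apply: dominated_x1 => //; try natlia.
    - by rewrite g0.
    - by apply/andP; split; rlra.
    - by rewrite -ler_pdivlMr.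
    - rewrite prednK; last natlia.
      by rewrite (S_recl a b) ?mulrDr; [rlra | natlia].
  exists (Num.min 1 (gam / E c) - y); split; first by rlra.
  have -> : y + (Num.min 1 (gam / E c) - y) = Num.min 1 (gam / E c) by ring.
  set x' := x - _; have xE : x' = x + y - Num.min 1 (gam / E c) by rewrite /x'; ring.
  have gx' : gam <= x' * E a by rewrite -ler_pdivrMr //; rlra.
  have x'1 : x' <= 1 by rlra.
  case: (leP gam (E c)) => gEc.
    have uE : Num.min 1 (gam / E c) = gam / E c.
      by apply/min_idPr; rewrite ler_pdivrMr // mul1r.
    (* Otherwise [E b.+1 <= gam <= E c < E b.+1]. *)
    have cb : c = b.+1.
      case: (ltnP b.+1 c) => bc; last natlia; exfalso.
      by have := E_lt b.+1 c isT bc Hc; have := gE1 bc; rlra.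
    rewrite uE in xE *; rewrite cb in Ec xE gEc xy Hc *.
    apply: dominated_eq => [k _|]; first by apply: profile_absorb_yb; natlia.
    apply: dominated_low => //; try natlia.
    - by rewrite g0.
    - by rewrite S_recr ?mulrDr ?dlt_recb; [rlra | natlia].
  have uE : Num.min 1 (gam / E c) = 1.
    by apply/min_idPl; rewrite ler_pdivlMr // mul1r ltW.
  have rb' : (r < b)%N.
    case: (ltnP r.+1 c) => rc; first exact: rb.
    by have cr : c = r.+1 by [natlia]; exfalso; rewrite cr in gEc; rlra.
  rewrite uE in xE *.
  apply: dominated_eq => [k _|]; first by apply: profile_absorb_y; natlia.
  apply: dominated_low => //; try natlia.
  - by rewrite g0 gE.
  - move=> bc; case: (ltnP b.+1 c) => [/gE1 //|cb].
    have -> : b.+1 = c by natlia.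
    exact: ltW.
  - by rlra.
apply: (dominated_line_xy _ _ _ _ _ _ (- T) U) => //.
  by rewrite oppr_le0 T0.
by rewrite opprK.
Qed.

(** * Reduction of a feasible point to a profile *)

(** Since [E] decreases, the cap of 1 and [gam / E t] is [gam / E t] up to [b] and 1 from there to
    [c]. As [gam <= E r.+1], the first part is nonempty once [c > r.+1]. *)
Lemma level_index gam c : gam <= E r.+1 -> (r < c)%N ->
  exists b, [/\ (r <= b < c)%N, forall t, (r < t <= b)%N -> gam <= E t,
    (b.+1 < c)%N -> E b.+1 <= gam & (r.+1 < c)%N -> (r < b)%N].
Proof.
move=> gE; elim: c => // c IH; rewrite ltnS leq_eqVlt => /orP[/eqP <-|rc].
  by exists r; split; natlia.
have [b [Hb lo hi rb]] := IH rc.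
case: (ltnP b.+1 c) => bc.
  by exists b; split=> // *; [natlia | apply: hi | apply: rb; natlia].
have cb : c = b.+1 by natlia.
case: (leP gam (E c)) => gc.
  exists c; split=> // [|t Ht|]; try natlia.
  by case: (eqVneq t c) => [->//|tc]; apply: lo; natlia.
exists b; split=> // *.
- by natlia.
- by rewrite -cb ltW.
- case: (ltnP r b) => // br; have cr : c = r.+1 by natlia.
  by exfalso; rewrite cr in gc; rlra.
Qed.

Lemma dominated_feasible q del : feasible n r E q del -> dominated q.
Proof.
move=> [[q01 sumq] lo hi].
(* Lowering [del] relaxes the constraints on [1, r]; those beyond [r] survive because
   [q t * E t <= E t <= E r.+1]. *)
pose gam := Num.min del (E r.+1).
have gdel : gam <= del by rewrite /gam ge_min lexx.
have gEr : gam <= E r.+1 by rewrite /gam ge_min lexx orbT.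
have g0 : 0 <= gam.
  have Er : 0 < E r.+1 by apply: E_gt0; natlia.
  rewrite le_min (ltW Er) andbT; apply: le_trans (hi r.+1 _); last natlia.
  apply: mulr_ge0; last exact: ltW.
  by have /andP[] := q01 r.+1 ltac:(natlia).
(* For fixed [gam] the constraints are intervals: from [gam / E k] to 1 on [1, r], and from 0 to the
   smaller of 1 and [gam / E k] on [r+1, n]. Each block is exchanged with its own mass kept. *)
have [||a [x [Ha Hx sum1 obj1]]] :=
  @greedy_exchange R 1 r.+1 (fun k => gam / E k) (fun=> 1) weight q ltac:(natlia).
- move=> k Hk; have Ek : 0 < E k by apply: E_gt0; natlia.
  have /andP[_ ->] := q01 k ltac:(natlia); rewrite andbT ler_pdivrMr //.
  by apply: le_trans gdel (lo k _); natlia.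
- move=> i j i1 ij jr; rewrite /weight; do ?[case: ifP; try natlia] => _ _.
  by rewrite ler_pM2l ?invr_gt0 ?ltr0n //; apply: E_le; natlia.
have [||c [y [Hc Hy sum2 obj2]]] :=
  @greedy_exchange R r.+1 n.+1 (fun=> 0) (fun k => Num.min 1 (gam / E k)) weight q
    ltac:(natlia).
- move=> k Hk; have Ek : 0 < E k by apply: E_gt0; natlia.
  have /andP[-> q1] := q01 k ltac:(natlia).
  rewrite le_min q1 /= ler_pdivlMr // /gam le_min.
  apply/andP; split; first by apply: hi; natlia.
  apply: (@le_trans _ _ (E k)); last by apply: E_le; natlia.
  by rewrite ger_pMl.
- move=> i j ri ij jn; rewrite /weight; do ?[case: ifP; try natlia] => _ _.
  by rewrite !mul1r; apply: E_le; natlia.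
have [b [Hb blo bhi rb]] := level_index gam c gEr ltac:(natlia).
pose P := profile a b c gam x y.
have eq1 k : (1 <= k < r.+1)%N ->
    (if (k < a)%N then 1 else if k == a then x else gam / E k) = P k.
  by move=> Hk; rewrite /P /profile; do ?[case: ifP; try natlia].
have eq2 k : (r.+1 <= k < n.+1)%N ->
    (if (k < c)%N then Num.min 1 (gam / E k) else if k == c then y else 0) = P k.
  move=> Hk; have Ek : 0 < E k by apply: E_gt0; natlia.
  have minE : (k < c)%N ->
      Num.min 1 (gam / E k) = if (k <= b)%N then gam / E k else 1.
    move=> kc; case: leqP => kb.
      by apply/min_idPr; rewrite ler_pdivrMr // mul1r; apply: blo; natlia.
    apply/min_idPl; rewrite ler_pdivlMr // mul1r.
    by apply: le_trans (bhi _); [apply: E_le|]; natlia.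
  rewrite /P /profile; case: (ltnP k c) => kc; first rewrite minE //;
    by do ?[case: ifP; try natlia].
have {}sum1 := etrans (esym (eq_big_nat _ _ eq1)) sum1.
have {}sum2 := etrans (esym (eq_big_nat _ _ eq2)) sum2.
have sumP : \sum_(1 <= k < n.+1) P k = r%:R.
  rewrite -sumq (big_cat_nat (n:=r.+1)) ?[RHS](big_cat_nat (n:=r.+1)) //=; try natlia.
  by rewrite sum1 sum2.
have objP : objective q <= objective P.
  rewrite !objective_weight (big_cat_nat (n:=r.+1)) //=; last natlia.
  rewrite [leRHS](big_cat_nat (n:=r.+1)) //=; last natlia.
  apply: lerD.
    by apply: le_trans obj1 _; apply: ler_sum_nat => k Hk; rewrite eq1.
  by apply: le_trans obj2 _; apply: ler_sum_nat => k Hk; rewrite eq2.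
apply: dominated_le objP _; apply: dominated_profile => //; try natlia.
- by rewrite g0.
- by move=> rb'; apply: blo; natlia.
- move: sumP; rewrite sum_profile; try natlia.
  by rewrite dltE => <-; ring.
Qed.

End Program.

Theorem theorem4 (R : realFieldType) (n r : nat) (E : nat -> R) :
  (2 <= n)%N -> (0 < r)%N -> (r < n)%N ->
  (* A1 *)
  (forall i, (1 <= i)%N -> (i < n)%N -> E i.+1 < E i) -> 0 < E n ->
  (* A2 *)
  (forall a b, (1 <= a <= r)%N -> (r < b <= n)%N ->
     forall z : int, E b * S E a b != z%:~R) ->
  (* (1) *)
  [/\ (forall a c, X1 n r E a c -> inI n r (p1 n r E a c)),
      (forall a b, X2 n r E a b -> inI n r (p2 n r E a b)),
      (forall b c, X3 n r E b c -> inI n r (p3 n r E b c)),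
  (* (2) *)
      [/\ feasible n r E (p0 R r) (gamma0 r E),
          (forall a c, X1 n r E a c -> feasible n r E (p1 n r E a c) (gamma1 n r E a c)),
          (forall a b, X2 n r E a b -> feasible n r E (p2 n r E a b) (gamma2 E a b)) &
          (forall b c, X3 n r E b c -> feasible n r E (p3 n r E b c) (gamma3 E b c))] &
  (* (3) *)
      (forall p gam, candidate n r E p gam ->
         (forall q del, candidate n r E q del -> objective n r E q <= objective n r E p) ->
         optimal n r E p gam)].
Proof.
move=> _ r0 rn Edec En Eni.
have F0 : feasible n r E (p0 R r) (gamma0 r E) by apply: feasible_p0.
have F1 a c : X1 n r E a c -> feasible n r E (p1 n r E a c) (gamma1 n r E a c).
  by apply: feasible_p1.
have F2 a b : X2 n r E a b -> feasible n r E (p2 n r E a b) (gamma2 E a b).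
  by apply: feasible_p2.
have F3 b c : X3 n r E b c -> feasible n r E (p3 n r E b c) (gamma3 E b c).
  by apply: feasible_p3.
split=> //.
- by move=> a c /F1 [].
- by move=> a b /F2 [].
- by move=> b c /F3 [].
move=> p gam C best; split.
  case: C => [[-> ->] //|[a [c [X -> ->]]]|[a [b [X -> ->]]]|[b [c [X -> ->]]]].
  - exact: F1.
  - exact: F2.
  - exact: F3.
move=> q del Fq.
have [q' [del' [C' qq']]] := @dominated_feasible R n r E r0 rn Edec En Eni q del Fq.
exact: le_trans qq' (best _ _ C').
Qed.
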